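(* Let $G$ be a noncomplete graph. Then $1 \leq \overline{e}pa(G) \leq \overline{E}pa(G)$. Moreover, (a) $\overline{e}pa(G) = 1$ if and only if there are nonadjacent (distinct) $\gamma$-bad vertices $u$ and $v$ of $G$ such that $u \notin V^-(G-v)$ and $v \notin V^-(G-u)$, and (b) $\overline{E}pa(G) = 1$ if and only if $\gamma(G) = 1$.
   Context: Graphs are finite and simple. $\gamma(H)$ denotes the domination number of a graph $H$; a $\gamma$-set of $H$ is a dominating set of $H$ of cardinality $\gamma(H)$. A vertex of $H$ is $\gamma$-bad if it belongs to no $\gamma$-set of $H$. $V^-(H) = \{x \in V(H) \mid \gamma(H-x) < \gamma(H)\}$. For distinct vertices $u,v$ of $G$ and an integer $k\geq 0$, $G_{u,v,k}$ denotes the graph obtained from the disjoint union of $G$ and a path $x_0,x_1,\dots,x_{k+1}$ by identifying $u$ with $x_0$ and $v$ with $x_{k+1}$ (so $k$ new vertices are added; for nonadjacent $u,v$, $G_{u,v,0}$ is $G$ with the edge $uv$ added). $pa(u,v)$ is the minimum integer $k\geq 0$ such that $\gamma(G) < \gamma(G_{u,v,k})$. $\overline{e}pa(G)$ and $\overline{E}pa(G)$ are, respectively, the minimum and the maximum of $pa(u,v)$ over all pairs of distinct nonadjacent vertices $u,v$ of $G$. *)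

(* Defs.v *)
From HB Require Import structures.
From mathcomp Require Import all_boot.
From mathcomp Require Import zify.

Set Implicit Arguments.
Unset Strict Implicit.
Unset Printing Implicit Defensive.

Record sgraph := SGraph {
  vertex :> finType;
  adj : rel vertex;
  adj_sym : symmetric adj;
  adj_irrefl : irreflexive adj }.

Definition complete (G : sgraph) : bool :=
  [forall u : G, forall v : G, (u != v) ==> adj u v].

Definition nonadjacent (G : sgraph) (u v : G) : bool :=
  (u != v) && ~~ adj u v.

Section Domination.
Variable G : sgraph.

Definition dominating (D : {set G}) : bool :=
  [forall x, (x \in D) || [exists y in D, adj x y]].

Lemma dominating_setT : dominating setT.
Proof. by apply/forallP => x; rewrite in_setT. Qed.

Definition gamma : nat :=
  #|[arg min_(D < [set: G] | dominating D) #|D| ]|.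

Definition gamma_set (D : {set G}) : bool :=
  dominating D && (#|D| == gamma).

Definition gamma_bad (x : G) : bool :=
  [forall D : {set G}, gamma_set D ==> (x \notin D)].

Lemma gamma_attained : exists D, gamma_set D.
Proof.
rewrite /gamma_set /gamma.
case: arg_minnP => [|D domD _]; first exact: dominating_setT.
by exists D; rewrite domD eqxx.
Qed.

Lemma gamma_min (D : {set G}) : dominating D -> gamma <= #|D|.
Proof.
rewrite /gamma; case: arg_minnP => [|D0 _ minD0]; first exact: dominating_setT.
exact: minD0.
Qed.

End Domination.

Section Deletion.
Variables (G : sgraph) (v : G).

Definition del_adj : rel {x : G | x != v} := fun a b => adj (val a) (val b).

Lemma del_adj_sym : symmetric del_adj.
Proof. by move=> a b; apply: adj_sym. Qed.

Lemma del_adj_irrefl : irreflexive del_adj.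
Proof. by move=> a; apply: adj_irrefl. Qed.

(* G - v; its vertices are carried back into G by [val]. *)
Definition del_vertex : sgraph := SGraph del_adj_sym del_adj_irrefl.

End Deletion.

(* V^-(G) *)
Definition Vminus (G : sgraph) : {set G} :=
  [set x | gamma (del_vertex x) < gamma G].

Section AddPath.
Variables (G : sgraph) (u v : G) (k : nat).

(* The vertices x_0 = u, x_1, ..., x_k, x_(k+1) = v of the attached path, with
   x_(i+1) = inr i for i < k; only indices at most k+1 are meaningful. *)
Definition path_vertex (i : nat) : G + 'I_k :=
  if i is j.+1 then (if insub j is Some o then inr o else inl v) else inl u.

Definition path_edge : rel (G + 'I_k) := fun a b =>
  [exists i : 'I_k.+1, (a == path_vertex i) && (b == path_vertex i.+1)].

Definition old_edge : rel (G + 'I_k) := fun a b =>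
  if (a, b) is (inl x, inl y) then adj x y else false.

(* The conjunct [a != b] only matters in the degenerate case u = v, k = 0. *)
Definition add_path_adj : rel (G + 'I_k) := fun a b =>
  (a != b) && [|| old_edge a b, path_edge a b | path_edge b a].

Lemma add_path_adj_sym : symmetric add_path_adj.
Proof.
move=> a b; rewrite /add_path_adj eq_sym; congr (_ && _).
rewrite [path_edge a b || _]orbC; congr (_ || _).
by case: a b => [x|i] [y|j] //=; apply: adj_sym.
Qed.

Lemma add_path_adj_irrefl : irreflexive add_path_adj.
Proof. by move=> a; rewrite /add_path_adj eqxx. Qed.

(* G_{u,v,k} *)
Definition add_path : sgraph := SGraph add_path_adj_sym add_path_adj_irrefl.

Lemma path_vertexS_inr (l : nat) (i : 'I_k) :
  path_vertex l = inr i -> l = i.+1.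
Proof. by case: l => //= j; case: insubP => // o _ <- [->]. Qed.

Lemma add_path_inner (i : 'I_k) (y : add_path) :
    0 < i -> i.+1 < k -> adj (inr i : add_path) y ->
  exists2 j : 'I_k, y = inr j & (i == j.+1 :> nat) || (j == i.+1 :> nat).
Proof.
move=> i_gt0 i_lt /andP[_ /or3P[||]] //.
- case/existsP => l /andP[/eqP/esym/path_vertexS_inr li /eqP->].
  rewrite li /=; case: insubP => [o _ ov|]; last by rewrite i_lt.
  by exists o; rewrite ?ov ?eqxx ?orbT.
- case/existsP => l /andP[/eqP-> /eqP/esym/path_vertexS_inr [li]].
  rewrite li; case: (val i) i_gt0 (ltn_ord i) => //= m _ mk.
  case: insubP => [o _ ov|]; last by rewrite ltnW.
  by exists o; rewrite ?ov ?eqxx.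
Qed.

End AddPath.

Lemma pa_exists (G : sgraph) (u v : G) :
  exists k, gamma G < gamma (add_path u v k).
Proof.
pose g := gamma G; pose k := 3 * g.+1; exists k.
have [D /andP[domD /eqP<-]] := gamma_attained (add_path u v k).
pose h (y : G + 'I_k) : nat := if y is inr j then j %/ 3 else 0.
have sub : {subset iota 0 g.+1 <= map h (enum D)}.
  move=> t; rewrite mem_iota add0n => /= t_lt.
  have tk : 3 * t + 1 < k by rewrite /k; lia.
  pose i := Ordinal tk.
  have /orP[iD|/existsP[y /andP[yD iy]]] := forallP domD (inr i).
    apply/mapP; exists (inr i); first by rewrite mem_enum.
    by rewrite /h /=; lia.
  have [||j yj ij] := add_path_inner _ _ iy; [by rewrite /=; lia.. |].
  apply/mapP; exists y; first by rewrite mem_enum.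
  by rewrite yj /h; move: ij; rewrite /=; lia.
have := uniq_leq_size (iota_uniq 0 g.+1) sub.
by rewrite size_iota size_map -cardE.
Qed.

Definition pa (G : sgraph) (u v : G) : nat := ex_minn (pa_exists u v).

Definition Ebar_pa (G : sgraph) : nat :=
  \max_(p : G * G | nonadjacent p.1 p.2) pa p.1 p.2.

(* The initial value [Ebar_pa G] bounds every term, so for noncomplete G this
   is the minimum of the terms (see [ebar_paP]). *)
Definition ebar_pa (G : sgraph) : nat :=
  \big[minn/Ebar_pa G]_(p : G * G | nonadjacent p.1 p.2) pa p.1 p.2.

Lemma noncomplete_pair (G : sgraph) :
  ~~ complete G -> exists p : G * G, nonadjacent p.1 p.2.
Proof.
case/forallPn => u /forallPn[v]; rewrite negb_imply => uv.
by exists (u, v).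
Qed.

Lemma Ebar_paP (G : sgraph) : ~~ complete G ->
  (exists2 p : G * G, nonadjacent p.1 p.2 & Ebar_pa G = pa p.1 p.2) /\
  (forall u v : G, nonadjacent u v -> pa u v <= Ebar_pa G).
Proof.
case/noncomplete_pair => p0 Pp0; split=> [|u v uv].
  have [|p Pp Ep] := @eq_bigmax_cond _ [pred p : G * G | nonadjacent p.1 p.2]
    (fun p => pa p.1 p.2); first by apply/card_gt0P; exists p0.
  by exists p.
exact: (@leq_bigmax_cond _ (fun p : G * G => nonadjacent p.1 p.2)
  (fun p => pa p.1 p.2) (u, v)).
Qed.

Lemma ebar_paP (G : sgraph) : ~~ complete G ->
  (exists2 p : G * G, nonadjacent p.1 p.2 & ebar_pa G = pa p.1 p.2) /\
  (forall u v : G, nonadjacent u v -> ebar_pa G <= pa u v).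
Proof.
move=> /Ebar_paP[[p0 Pp0 Ep0] _]; split=> [|u v uv].
  rewrite /ebar_pa; elim/big_ind: _ => [|m n [p Pp ->] [q Pq ->]|p Pp].
  - by exists p0.
  - by rewrite /minn; case: ifP => _; [exists p | exists q].
  - by exists p.
rewrite /ebar_pa; have: (u, v) \in index_enum (G * G)%type by rewrite mem_index_enum.
elim: index_enum => // p s IHs; rewrite inE big_cons => /predU1P[<-|/IHs le_s].
  by rewrite uv geq_minl.
by case: ifP => // _; rewrite geq_min le_s orbT.
Qed.

(* Main.v *)
Require Import Defs.
From mathcomp Require Import all_boot.

Set Implicit Arguments.
Unset Strict Implicit.
Unset Printing Implicit Defensive.

(** Let x be the inner vertex of the path added in G_(u,v,1). A dominating set
of G_(u,v,1) either avoids x, and is then a dominating set of G meeting {u, v},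
or contains x, and then its trace on G dominates G except possibly u and v.
Hence pa(u,v) = 1 iff u and v are gamma-bad and fewer than gamma(G) vertices
never dominate all of G but u and v. For gamma-bad u and v such a trace avoids
u and v (otherwise adding one of them gives a gamma-set), so the latter
condition reads gamma(G-u-v) >= gamma(G), while gamma(G-u) = gamma(G-v) =
gamma(G); this is (a). For (b), no nonadjacent pair with pa = 1 meets a
gamma-set, so if all have pa = 1 then every vertex of a gamma-set is adjacent
to all others. *)

(** * Domination of all vertices outside a given set *)

(** [D] may meet [S], as the trace of a dominating set of $G_{u,v,1}$ can; for sets living in $G-v$,
    disjointness is a separate condition. *)
Definition dominates_off (G : sgraph) (S D : {set G}) : Prop :=
  forall x, x \notin S -> x \in D \/ exists2 y, y \in D & adj x y.

Lemma dominatingP (G : sgraph) (D : {set G}) :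
  reflect (dominates_off set0 D) (dominating D).
Proof.
apply: (iffP forallP) => [domD x _|domD x].
  by case/orP: (domD x) => [|/exists_inP]; [left | right].
case: (domD x) => [|->//|xD]; first by rewrite inE.
by apply/orP; right; apply/exists_inP.
Qed.

(** With [n] equal to [gamma G] this yields a minimum dominating set; for other [n] it turns a set
    into an upper bound. *)
Lemma leq_gammaP (G : sgraph) n :
  gamma G <= n <-> exists2 D : {set G}, dominates_off set0 D & #|D| <= n.
Proof.
split=> [le_n|[D /dominatingP/gamma_min]]; last exact: leq_trans.
have [D /andP[/dominatingP domD /eqP cardD]] := gamma_attained G.
by exists D; rewrite ?cardD.
Qed.

Lemma dominating_neq0 (G : sgraph) (x : G) (D : {set G}) :
  dominates_off set0 D -> exists w, w \in D.
Proof.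
move=> domD; case: (domD x) => [|xD|[y yD _]]; first by rewrite inE.
  by exists x.
by exists y.
Qed.

Lemma dominates_off_setU1 (G : sgraph) (S D : {set G}) v :
  dominates_off (v |: S) D -> dominates_off S (v |: D).
Proof.
move=> domD x xS; case: (eqVneq x v) => [->|xv]; first by left; rewrite setU11.
case: (domD x) => [|xD|[y yD xy]]; first by rewrite !inE negb_or xv.
  by left; rewrite setU1r.
by right; exists y; rewrite ?setU1r.
Qed.

Lemma dominates_off_subset (G : sgraph) (S T D : {set G}) :
  S \subset T -> dominates_off S D -> dominates_off T D.
Proof. by move=> /subsetP ST domD x xT; apply/domD/(contra (ST x)). Qed.

(** * Vertex deletion expressed inside $G$ *)

(** [v] lies outside the image of [val], so it only has to join the exempt set. *)
Lemma dominates_off_del (G : sgraph) (v : G) (S D : {set del_vertex v}) :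
  dominates_off S D <-> dominates_off (v |: val @: S) (val @: D).
Proof.
split=> domD x.
  rewrite !inE negb_or => /andP[xv xS].
  case: (domD (Sub x xv)) => [|xD|[y yD xy]].
  - by apply: contra xS => /(imset_f val).
  - by left; move/(imset_f val): xD.
  - by right; exists (val y); rewrite ?imset_f.
move=> xS; case: (domD (val x)) => [||[_ /imsetP[y yD ->] xy]].
- by rewrite !inE negb_or (valP x) (mem_imset _ _ val_inj).
- by rewrite (mem_imset _ _ val_inj); left.
- by right; exists y.
Qed.

Lemma imset_val_del (G : sgraph) (v : G) (D : {set G}) :
  v \notin D -> exists E : {set del_vertex v}, val @: E = D.
Proof.
move=> vD; exists [set x | val x \in D]; apply/setP => x.
apply/imsetP/idP => [[y yD ->]|xD]; first by rewrite inE in yD.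
have xv : x != v by apply: contraNneq vD => <-.
by exists (Sub x xv); rewrite ?inE.
Qed.

Lemma leq_gamma_delP (G : sgraph) (v : G) n :
  gamma (del_vertex v) <= n <->
  exists D : {set G}, [/\ dominates_off [set v] D, v \notin D & #|D| <= n].
Proof.
rewrite leq_gammaP; split=> [[D /dominates_off_del domD cardD]|[D [domD vD]]].
  exists (val @: D); rewrite imset0 setU0 in domD.
  split=> //; last by rewrite card_imset //; apply: val_inj.
  by apply/imsetP => -[y _ vy]; have := valP y; rewrite /= -vy eqxx.
have [E defD] := imset_val_del vD; rewrite -defD => cardD.
exists E; last by rewrite card_imset // in cardD; apply: val_inj.
by apply/dominates_off_del; rewrite imset0 setU0 defD.
Qed.

Lemma leq_gamma_del2P (G : sgraph) (v : G) (u : del_vertex v) n :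
  gamma (del_vertex u) <= n <->
  exists D : {set G},
    [/\ dominates_off [set val u; v] D, val u \notin D, v \notin D & #|D| <= n].
Proof.
rewrite leq_gamma_delP; split=> [[D [/dominates_off_del domD uD cardD]]|].
  exists (val @: D); rewrite imset_set1 setUC in domD.
  rewrite card_imset ?(mem_imset _ _ val_inj) //; last exact: val_inj.
  split=> //; apply/imsetP => -[y _ vy].
  by have := valP y; rewrite /= -vy eqxx.
case=> D [domD uD vD]; have [E defD] := imset_val_del vD.
rewrite -defD (mem_imset _ _ val_inj) in uD *.
rewrite card_imset => [cardD|]; last exact: val_inj.
exists E; split=> //.
by apply/dominates_off_del; rewrite imset_set1 setUC defD.
Qed.

(** * Bad vertices and $V^-$ *)

Lemma gamma_badP (G : sgraph) (v : G) :
  reflect (forall D : {set G}, dominates_off set0 D -> #|D| <= gamma G ->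
             v \notin D)
          (gamma_bad v).
Proof.
apply: (iffP forall_inP) => [bad D domD cardD|bad D /andP[domD /eqP cardD]].
  apply: bad; rewrite /gamma_set eqn_leq cardD gamma_min ?andbT //;
  exact/dominatingP.
by apply: bad; [apply/dominatingP | rewrite cardD].
Qed.

(** A gamma-set of $G$ avoids [v], so it dominates $G-v$; adding [v] to a smaller dominating set of
    $G-v$ would give a gamma-set containing [v]. *)
Lemma gamma_del_bad (G : sgraph) (v : G) :
  gamma_bad v -> gamma (del_vertex v) = gamma G.
Proof.
move/gamma_badP => bad; apply/eqP; rewrite eqn_leq; apply/andP; split.
  have /leq_gammaP[D domD cardD] := leqnn (gamma G).
  apply/leq_gamma_delP; exists D; split=> //; last exact: bad.
  exact: dominates_off_subset (sub0set _) domD.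
have /leq_gamma_delP[D [domD vD cardD]] := leqnn (gamma (del_vertex v)).
rewrite leqNgt; apply/negP => lt_g.
have /negP[] : v \notin v |: D; last exact: setU11.
apply: bad; last by rewrite cardsU1 vD (leq_trans _ lt_g).
by apply: dominates_off_setU1; rewrite setU0.
Qed.

(** Nonmembership means $\gamma(G-v) \leq \gamma(G-v-u)$, and the sets [D] are the dominating sets
    of $G-v-u$ seen in $G$. *)
Lemma notin_Vminus_delP (G : sgraph) (u v : G) : u != v ->
  reflect
    (forall D : {set G}, dominates_off [set u; v] D ->
       u \notin D -> v \notin D -> gamma (del_vertex v) <= #|D|)
    (u \notin [set val x | x in Vminus (del_vertex v)]).
Proof.
move=> uv; pose w : del_vertex v := Sub u uv.
have -> : u = val w by [].
rewrite (mem_imset _ _ val_inj) inE -leqNgt.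
apply: (iffP idP) => [le_g D domD uD vD|le_g].
  by apply: leq_trans le_g _; apply/leq_gamma_del2P; exists D.
have /leq_gamma_del2P[D [domD uD vD]] := leqnn (gamma (del_vertex w)).
by apply: leq_trans; apply: le_g.
Qed.

(** * Paths with at most one inner vertex *)

Lemma adj_add_path_inl (G : sgraph) (u v : G) k (x y : G) :
  adj x y -> adj (inl x : add_path u v k) (inl y).
Proof.
move=> xy; apply/andP; split; last by rewrite /old_edge xy.
by apply: contraTneq xy => -[->]; rewrite adj_irrefl.
Qed.

Lemma path_edge1 (G : sgraph) (u v : G) (a b : G + 'I_1) :
  path_edge u v a b =
    (a == inl u) && (b == inr ord0) || (a == inr ord0) && (b == inl v).
Proof.
have p1 : @path_vertex G u v 1 1 = inr ord0.
  by rewrite /=; case: insubP => //= o _ _; rewrite [o]ord1.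
(* The shifted index 1 is out of range for ['I_1], so [path_vertex] falls back to the endpoint
   [v]. *)
have p2 : @path_vertex G u v 1 2 = inl v by rewrite /= insubF.
apply/existsP/orP => [[i]|[] ab]; last 2 first.
- by exists ord0; rewrite p1.
- by exists ord_max; rewrite p1 p2.
case: i => -[|[|//]] i_lt; rewrite ?p2 p1; [by left | by right].
Qed.

(** Both edges of the added path contain the new vertex, so old adjacencies are unchanged. *)
Lemma adj_add_path1_inl (G : sgraph) (u v x y : G) :
  adj (inl x : add_path u v 1) (inl y) = adj x y.
Proof.
apply/idP/idP; last exact: adj_add_path_inl.
by case/andP => _; rewrite !path_edge1 /= !andbF !orbF.
Qed.

Lemma adj_add_path1_inr (G : sgraph) (u v : G) (i : 'I_1) (y : G) :
  adj (inr i : add_path u v 1) (inl y) = (y \in [set u; v]).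
Proof.
rewrite [i]ord1 /= /add_path_adj !path_edge1 /= !inE orbC.
by rewrite eqxx andbT orbF.
Qed.

(** No vertex is added for $k = 0$ and edges can only be gained, so dominating sets persist. *)
Lemma gamma_add_path0 (G : sgraph) (u v : G) :
  gamma (add_path u v 0) <= gamma G.
Proof.
have /leq_gammaP[D domD cardD] := leqnn (gamma G).
apply/leq_gammaP; exists (inl @: D); last first.
  by rewrite card_imset // => x y [].
move=> [x _|[]//]; case: (domD x) => [|xD|[y yD xy]]; first by rewrite inE.
  by left; apply: imset_f.
by right; exists (inl y); [apply: imset_f | apply: adj_add_path_inl].
Qed.

(** The alternatives are the sets without and with the new vertex; the strict bound in the second
    pays for it. *)
Lemma leq_gamma_add_path1P (G : sgraph) (u v : G) n :
  gamma (add_path u v 1) <= n <->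
  (exists D : {set G},
     [/\ dominates_off set0 D, (u \in D) || (v \in D) & #|D| <= n])
  \/ (exists2 D : {set G}, dominates_off [set u; v] D & #|D| < n).
Proof.
have inl_inj : injective (inl : G -> add_path u v 1) by move=> x y [].
pose x0 : add_path u v 1 := inr ord0.
have x0_inl (E : {set G}) : x0 \notin [set (inl x : add_path u v 1) | x in E].
  by apply/imsetP => -[].
rewrite leq_gammaP; split=> [[D domD cardD]|]; last first.
  case=> [[D [domD uvD cardD]]|[D domD cardD]].
    exists (inl @: D); last by rewrite card_imset.
    move=> [x _|i _].
      case: (domD x) => [|xD|[y yD xy]]; first by rewrite inE.
        by left; apply: imset_f.
      by right; exists (inl y); [apply: imset_f | apply: adj_add_path_inl].
    right; case/orP: uvD => wD;
    by eexists; [exact: imset_f wD | rewrite adj_add_path1_inr !inE eqxx ?orbT].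
  exists (x0 |: [set inl x | x in D]); last first.
    by rewrite cardsU1 x0_inl card_imset.
  move=> [x _|i _]; last by left; rewrite [i]ord1 setU11.
  case: (boolP (x \in [set u; v])) => [xuv|/domD[xD|[y yD xy]]].
  - right; exists x0; first exact: setU11.
    by rewrite adj_sym adj_add_path1_inr.
  - by left; rewrite setU1r // imset_f.
  - right; exists (inl y); first by rewrite setU1r // imset_f.
    exact: adj_add_path_inl.
pose E : {set G} := [set x | (inl x : add_path u v 1) \in D].
have subE : [set inl x | x in E] \subset D.
  by apply/subsetP => _ /imsetP[x xE ->]; rewrite inE in xE.
have [x0D|x0D] := boolP (x0 \in D).
  right; exists E.
    move=> x xuv; case: (domD (inl x)) => [|xD|[[y|i] yD xy]].
    - by rewrite inE.
    - by left; rewrite inE.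
    - by right; exists y; rewrite ?inE // -(adj_add_path1_inl u v).
    (* The only old vertices that the new one dominates are [u] and [v]. *)
    - by move: xy; rewrite adj_sym adj_add_path1_inr (negPf xuv).
  apply: leq_trans cardD; rewrite (cardsD1 x0 D) x0D ltnS.
  rewrite -(card_imset E inl_inj); apply/subset_leq_card.
  by rewrite subsetD1 subE x0_inl.
have x0N i : inr i \in D = false by rewrite [i]ord1 (negPf x0D).
left; exists E; split.
- move=> x _; case: (domD (inl x)) => [|xD|[[y|i] yD xy]].
  + by rewrite inE.
  + by left; rewrite inE.
  + by right; exists y; rewrite ?inE // -(adj_add_path1_inl u v).
  + by rewrite x0N in yD.
(* The new vertex is not in [D], so [u] or [v] must dominate it. *)
- case: (domD x0) => [||[[y|i] yD]]; first by rewrite inE.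
  + by rewrite (negPf x0D).
  + rewrite adj_add_path1_inr !inE.
    by move=> /orP[/eqP<-|/eqP<-]; rewrite yD ?orbT.
  + by rewrite x0N in yD.
- by apply: leq_trans cardD; rewrite -(card_imset E inl_inj) subset_leq_card.
Qed.

(** * Pairs with $pa(u,v) = 1$ *)

Lemma pa_gt0 (G : sgraph) (u v : G) : 0 < pa u v.
Proof.
rewrite /pa; case: ex_minnP => -[|//] lt_g _.
by rewrite ltnNge gamma_add_path0 in lt_g.
Qed.

Lemma pa_eq1 (G : sgraph) (u v : G) :
  pa u v = 1 <->
  [/\ gamma_bad u, gamma_bad v
    & forall D : {set G}, dominates_off [set u; v] D -> gamma G <= #|D|].
Proof.
(* As [pa] is positive, it equals 1 exactly when $k = 1$ already raises the domination number. *)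
have -> : pa u v = 1 <-> gamma G < gamma (add_path u v 1).
  split=> [|lt_g]; first by rewrite /pa; case: ex_minnP => m lt_m _ <-.
  apply/eqP; rewrite eqn_leq pa_gt0 andbT /pa.
  by case: ex_minnP => m _; apply.
split=> [lt_g|[/gamma_badP badu /gamma_badP badv le_g]].
  have bad w : w \in [set u; v] -> gamma_bad w.
    rewrite !inE => w_uv; apply/gamma_badP => D domD cardD.
    apply: contraL lt_g => wD; rewrite -leqNgt; apply/leq_gamma_add_path1P.
    by left; exists D; case/orP: w_uv wD => /eqP-> ->; rewrite ?orbT.
  split; try by apply: bad; rewrite !inE eqxx ?orbT.
  move=> D domD; rewrite leqNgt; apply/negP => cardD.
  move: lt_g; rewrite ltnNge => /negP[]; apply/leq_gamma_add_path1P.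
  by right; exists D.
rewrite ltnNge; apply/negP => /leq_gamma_add_path1P[].
  case=> D [domD uvD cardD].
  by move: uvD; rewrite (negPf (badu _ _ _)) ?(negPf (badv _ _ _)).
by case=> D /le_g; rewrite leqNgt => /negP.
Qed.

(* If [D] contained [u], then [v |: D] would be a gamma-set containing [v]. *)
Lemma small_dominates_off_bad (G : sgraph) (u v : G) (D : {set G}) :
  gamma_bad v -> dominates_off [set u; v] D -> #|D| < gamma G -> u \notin D.
Proof.
move=> /gamma_badP bad domD cardD; apply/negP => uD.
have /negP[] : v \notin v |: D; last exact: setU11.
apply: bad; last by rewrite cardsU1; case: (v \notin D); rewrite // ltnW.
apply: dominates_off_setU1 => x; rewrite setU0 !inE => xv.
case: (eqVneq x u) => [->|xu]; first by left.
by apply: domD; rewrite !inE negb_or xu.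
Qed.

Lemma pa_eq1_Vminus (G : sgraph) (u v : G) : u != v ->
  pa u v = 1 <->
  [/\ gamma_bad u, gamma_bad v,
      u \notin [set val x | x in Vminus (del_vertex v)]
    & v \notin [set val x | x in Vminus (del_vertex u)]].
Proof.
move=> uv; have vu : v != u by rewrite eq_sym.
rewrite pa_eq1; split=> [[badu badv le_g]|[badu badv]].
  split=> //; [apply/notin_Vminus_delP | apply/notin_Vminus_delP] => //= D domD _ _.
    by rewrite gamma_del_bad ?le_g.
  by rewrite gamma_del_bad ?le_g // setUC.
move=> /(notin_Vminus_delP uv); rewrite gamma_del_bad // => le_g _.
split=> // D domD; rewrite leqNgt; apply/negP => cardD.
(* A smaller [D] must avoid both [u] and [v], hence it dominates $G-u-v$, against the $V^-$
   condition. *)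
have uD := small_dominates_off_bad badv domD cardD.
rewrite setUC in domD.
have vD := small_dominates_off_bad badu domD cardD.
by rewrite setUC in domD; have := le_g D domD uD vD; rewrite leqNgt cardD.
Qed.

(** * Graphs with domination number one, and the conclusion *)

Lemma pa_gamma1 (G : sgraph) (u v : G) :
  gamma G = 1 -> nonadjacent u v -> pa u v = 1.
Proof.
move=> g1 /andP[uv nadj].
(* A gamma-set is now a single vertex adjacent to all others, so a vertex with a nonneighbour is
   bad. *)
have bad (x y : G) : x != y -> ~~ adj x y -> gamma_bad x.
  move=> xy nxy; apply/gamma_badP => D domD; rewrite g1 => cardD.
  apply/negP => xD; have defD := card_le1_eqP cardD.
  case: (domD y) => [|yD|[z zD yz]]; first by rewrite inE.
    by case/eqP: xy; apply: defD.
  by case/negP: nxy; rewrite (defD z x) // adj_sym.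
apply/pa_eq1; split; [exact: bad uv nadj | | ].
  by apply: (bad v u); rewrite 1?eq_sym // adj_sym.
(* An empty [D] would leave undominated the vertex [w] of a gamma-set, which is neither [u] nor
   [v]. *)
move=> D domD; rewrite g1 card_gt0; apply/eqP => D0.
have /leq_gammaP[E domE cardE] := leqnn (gamma G).
have [w wE] := dominating_neq0 u domE.
have := bad u v uv nadj; move/gamma_badP/(_ E domE cardE) => uE.
have vE : v \notin E.
  by apply: (gamma_badP _ _ E domE cardE); apply: (bad v u);
  rewrite 1?eq_sym // adj_sym.
case: (domD w) => [|| [y]]; rewrite ?D0 ?inE //.
rewrite negb_or; apply/andP.
by split; [apply: contraNneq uE | apply: contraNneq vE] => <-.
Qed.

Lemma gamma1_pa (G : sgraph) : ~~ complete G ->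
  (forall u v : G, nonadjacent u v -> pa u v = 1) -> gamma G = 1.
Proof.
(* Noncompleteness supplies a vertex, so a minimum dominating set is nonempty. *)
move=> /noncomplete_pair[[u _] _] pa1.
have /leq_gammaP[D domD cardD] := leqnn (gamma G).
have [w wD] := dominating_neq0 u domD.
apply/eqP; rewrite eqn_leq; apply/andP; split.
  apply/leq_gammaP; exists [set w]; last by rewrite cards1.
  move=> x _; case: (eqVneq x w) => [->|xw]; first by left; rewrite set11.
  right; exists w; first exact: set11.
  (* If [x] were not adjacent to [w], then $pa(x,w) = 1$ would make [w] bad, although it lies in
     [D]. *)
  apply: contraLR wD => nxw.
  have /pa1/pa_eq1[_ /gamma_badP bad _] : nonadjacent x w by rewrite /nonadjacent xw.
  exact: bad.
rewrite lt0n; apply: contraTneq cardD => ->.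
by rewrite leqn0 cards_eq0; apply/set0Pn; exists w.
Qed.

Theorem corollary13 (G : sgraph) (hG : ~~ complete G) :
  (1 <= ebar_pa G <= Ebar_pa G)
  /\ (ebar_pa G = 1 <->
      exists u v : G,
        [/\ nonadjacent u v, gamma_bad u, gamma_bad v,
            u \notin [set val x | x in Vminus (del_vertex v)]
          & v \notin [set val x | x in Vminus (del_vertex u)]])
  /\ (Ebar_pa G = 1 <-> gamma G = 1).
Proof.
have [[[u v] /= uv ebarE] ebar_le] := ebar_paP hG.
have [[[u' v'] /= uv' EbarE] le_Ebar] := Ebar_paP hG.
split; first by rewrite {1}ebarE pa_gt0 EbarE ebar_le.
split; split.
- rewrite ebarE => /pa_eq1_Vminus[|*]; first by case/andP: uv.
  by exists u, v.
- case=> x [y [xy bx bY xV yV]]; apply/eqP; rewrite eqn_leq {2}ebarE pa_gt0 andbT.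
  have <- : pa x y = 1 by apply/pa_eq1_Vminus => //; case/andP: xy.
  exact: ebar_le.
(* Positivity and a maximum of 1 force every value of [pa] to be 1. *)
- move=> E1; apply: gamma1_pa => // x y xy.
  by apply/eqP; rewrite eqn_leq pa_gt0 -E1 le_Ebar.
- by move=> g1; rewrite EbarE; apply: pa_gamma1.
Qed.
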